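(* Let $m_1,\dots,m_n>-4$ be integers with $\sum_im_i=4(2g-2)$, and suppose that some cone has odd topological valence, that is, some $m_i$ is odd. Then $E(X,p,m)\subseteq\{1\}$ for every compact Riemann surface $X$ of genus $g$ and every choice of distinct points $p_1,\dots,p_n\in X$. Hence if a $4$-differential $q$ with divisor $\sum_im_ip_i$ exists on $(X,p)$ at all, it is primitive, with $\operatorname{im}\rho_q=\mathbb{Z}_4$.
   Context: $\mathbb{Z}_4=\mathbb{Z}/4\mathbb{Z}$, identified with the fourth roots of unity via $k\mapsto i^k$. For $(X,p,m)$ as in the claim, $$E(X,p,m)=\Big\{e\ge1,\ e\mid 4\ :\ e\mid m_i\ \text{for all } i\ \text{ and }\ \textstyle\sum_i(m_i/e)p_i\sim (4/e)K_X\Big\},$$ where $\sim$ is linear equivalence and $K_X$ a canonical divisor. The topological valence of the cone $p_i$ is $m_i+4$. A $k$-differential is a nonzero meromorphic section of $K_X^k$; it is primitive if it is not the $e$-th power of a $(k/e)$-differential for any $e>1$ dividing $k$. The rotational holonomy of a $4$-differential $q$ with divisor $\sum_im_ip_i$ is the homomorphism $\rho_q\colon H_1(X\setminus\{p_1,\dots,p_n\};\mathbb{Z})\to\mathbb{Z}_4$ given by the monodromy of local fourth roots of $q$: continuing a local fourth root along $\gamma$ multiplies it by $i^{\rho_q(\gamma)}$. *)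

(* Defs.v *)
From HB Require Import structures.
From mathcomp Require Import all_boot all_order all_algebra.
From mathcomp Require Import generic_quotient ring_quotient.
From mathcomp Require Import all_classical all_reals all_analysis.
From mathcomp Require Import complex freeg.

Set Implicit Arguments.
Unset Strict Implicit.
Unset Printing Implicit Defensive.

Import Order.TTheory GRing.Theory Num.Theory.
Import numFieldNormedType.Exports.

Local Open Scope classical_set_scope.
Local Open Scope ring_scope.
Local Open Scope quotient_scope.

(* The field R[i], with the topology and the normed space structure over itself
   that every numFieldType carries. *)
Definition Cplx (R : realType) : numClosedFieldType := R[i]%C.

Section StandardSimplices.
Variable R : realType.

Definition simplex1 : set R := `[0, 1].

(* (s, t) stands for the point (1 - s - t) v0 + s v1 + t v2. *)
Definition simplex2 : set (R * R)%type :=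
  [set st | [/\ 0 <= st.1, 0 <= st.2 & st.1 + st.2 <= 1]].

Lemma simplex1_0 : 0 \in simplex1.
Proof. by apply/mem_set; rewrite /simplex1 /= in_itv /= lexx ler01. Qed.

Lemma simplex1_1 : 1 \in simplex1.
Proof. by apply/mem_set; rewrite /simplex1 /= in_itv /= lexx ler01. Qed.

Definition t0 : simplex1 := exist _ 0 simplex1_0.
Definition t1 : simplex1 := exist _ 1 simplex1_1.

Lemma edge01_subproof (t : simplex1) : (\val t, 0) \in simplex2.
Proof.
case: t => t /= /set_mem; rewrite /simplex1 /= in_itv /= => /andP[t_ge0 t_le1].
by apply/mem_set; rewrite /simplex2 /= addr0.
Qed.

Lemma edge02_subproof (t : simplex1) : (0, \val t) \in simplex2.
Proof.
case: t => t /= /set_mem; rewrite /simplex1 /= in_itv /= => /andP[t_ge0 t_le1].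
by apply/mem_set; rewrite /simplex2 /= add0r.
Qed.

Lemma edge12_subproof (t : simplex1) : (1 - \val t, \val t) \in simplex2.
Proof.
case: t => t /= /set_mem; rewrite /simplex1 /= in_itv /= => /andP[t_ge0 t_le1].
by apply/mem_set; rewrite /simplex2 /= subrK subr_ge0.
Qed.

Definition edge01 (t : simplex1) : simplex2 :=
  exist (fun st => st \in simplex2) _ (edge01_subproof t).
Definition edge02 (t : simplex1) : simplex2 :=
  exist (fun st => st \in simplex2) _ (edge02_subproof t).
Definition edge12 (t : simplex1) : simplex2 :=
  exist (fun st => st \in simplex2) _ (edge12_subproof t).

Lemma val_simplex1_continuous : continuous (\val : simplex1 -> R).
Proof. exact: initial_continuous. Qed.

Lemma edge01_continuous : continuous edge01.
Proof.
apply/continuous_comp_initial => t.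
change {for t, continuous (fun u : simplex1 => (\val u, 0) : R * R)}.
exact: (cvg_pair (@val_simplex1_continuous t) (cvg_cst _)).
Qed.

Lemma edge02_continuous : continuous edge02.
Proof.
apply/continuous_comp_initial => t.
change {for t, continuous (fun u : simplex1 => (0, \val u) : R * R)}.
exact: (cvg_pair (cvg_cst _) (@val_simplex1_continuous t)).
Qed.

Lemma edge12_continuous : continuous edge12.
Proof.
apply/continuous_comp_initial => t.
change {for t, continuous (fun u : simplex1 => (1 - \val u, \val u) : R * R)}.
exact: (cvg_pair (cvgB (cvg_cst _) (@val_simplex1_continuous t))
                 (@val_simplex1_continuous t)).
Qed.

HB.instance Definition _ :=
  isContinuous.Build simplex1 simplex2 edge01 edge01_continuous.
HB.instance Definition _ :=
  isContinuous.Build simplex1 simplex2 edge02 edge02_continuous.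
HB.instance Definition _ :=
  isContinuous.Build simplex1 simplex2 edge12 edge12_continuous.

End StandardSimplices.
Arguments simplex1 R : clear implicits.
Arguments simplex2 R : clear implicits.
Arguments t0 R : clear implicits.
Arguments t1 R : clear implicits.

Section Homology.
Variables (R : realType) (T : topologicalType).

Definition singular1 := continuousType (simplex1 R) T.
Definition singular2 := continuousType (simplex2 R) T.
HB.instance Definition _ := Choice.on singular1.
HB.instance Definition _ := Choice.on singular2.

Definition chain0 := {freeg T}.
Definition chain1 := {freeg singular1}.
Definition chain2 := {freeg singular2}.
HB.instance Definition _ := GRing.Lmodule.on chain0.
HB.instance Definition _ := GRing.Lmodule.on chain1.
HB.instance Definition _ := GRing.Lmodule.on chain2.

Definition face01 (s : singular2) : singular1 := s \o @edge01 R.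
Definition face02 (s : singular2) : singular1 := s \o @edge02 R.
Definition face12 (s : singular2) : singular1 := s \o @edge12 R.

Definition boundary1 : chain1 -> chain0 :=
  fglift (fun s : singular1 => << s (t1 R) >> - << s (t0 R) >> : {freeg T}).

Definition boundary2 : chain2 -> chain1 :=
  fglift (fun s : singular2 =>
    << face12 s >> - << face02 s >> + << face01 s >> : {freeg singular1}).

HB.instance Definition _ :=
  GRing.isZmodMorphism.Build chain1 chain0 boundary1 (lift_is_additive _).
HB.instance Definition _ :=
  GRing.isZmodMorphism.Build chain2 chain1 boundary2 (lift_is_additive _).

Definition is_cycle : {pred chain1} := fun c => boundary1 c == 0.

Lemma is_cycle_zmod_closed : zmod_closed is_cycle.
Proof.
split=> [|c d]; rewrite !unfold_in; first by rewrite raddf0.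
by rewrite raddfB /= => /eqP-> /eqP->; rewrite subrr.
Qed.
HB.instance Definition _ :=
  GRing.isZmodClosed.Build chain1 is_cycle is_cycle_zmod_closed.

Record cycle1 := Cycle1 { cycle_chain :> chain1; _ : cycle_chain \in is_cycle }.
HB.instance Definition _ := [isSub for cycle_chain].
HB.instance Definition _ := [Choice of cycle1 by <:].
HB.instance Definition _ := [SubChoice_isSubZmodule of cycle1 by <:].

Definition is_boundary : {pred cycle1} :=
  fun z => `[< exists b : chain2, boundary2 b = z >].

Lemma is_boundary_zmod_closed : zmod_closed is_boundary.
Proof.
split=> [|y z].
  by apply/asboolP; exists 0; rewrite !raddf0.
move=> /asboolP[b by_] /asboolP[c cz]; apply/asboolP; exists (b - c).
by rewrite raddfB /= by_ cz.
Qed.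
HB.instance Definition _ :=
  GRing.isZmodClosed.Build cycle1 is_boundary is_boundary_zmod_closed.

Definition H1 : zmodType := Quotient.quot is_boundary.

Lemma loop_is_cycle (s : singular1) :
  s (t0 R) = s (t1 R) -> (<< s >> : chain1) \in is_cycle.
Proof. by move=> s01; rewrite unfold_in /boundary1 liftU s01 subrr scaler0. Qed.

Definition loop_class (s : singular1) (s01 : s (t0 R) = s (t1 R)) : H1 :=
  \pi_(Quotient.quot is_boundary) (Cycle1 (loop_is_cycle s01)).

End Homology.

Section Holomorphy.
Variable R : realType.
Implicit Types (f g : Cplx R -> Cplx R) (z : Cplx R) (n : int).

Definition holomorphic_at f z : Prop := \forall w \near z, derivable f w 1.

(* The equation is required at z itself as well.  As 0 ^ n = 0 for n < 0, this
   normalizes f to take the value 0 at its poles and excludes removable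
   singularities, so that equal meromorphic functions are pointwise equal. *)
Definition has_order f z n : Prop :=
  exists g, [/\ holomorphic_at g z, g z != 0
              & \forall w \near z, f w = (w - z) ^ n * g w].

Definition meromorphic_at f z : Prop :=
  (\forall w \near z, f w = 0) \/ exists n, has_order f z n.

End Holomorphy.

Record chart (R : realType) (X : topologicalType) := Chart {
  chart_dom : set X;
  chart_map :> X -> Cplx R;
  chart_inv : Cplx R -> X;
  chart_dom_open : open chart_dom;
  chart_codom_open : open (chart_map @` chart_dom);
  chart_mapK : forall x, chart_dom x -> chart_inv (chart_map x) = x;
  chart_map_continuous : {within chart_dom, continuous chart_map};
  chart_inv_continuous : {within chart_map @` chart_dom, continuous chart_inv}
}.

Definition transition (R : realType) (X : topologicalType) (c c' : chart R X) :
  Cplx R -> Cplx R := c' \o chart_inv c.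

Record riemannSurface (R : realType) := RiemannSurface {
  rs_space :> topologicalType;
  rs_nonempty : [set: rs_space] !=set0;
  rs_connected : connected [set: rs_space];
  rs_hausdorff : hausdorff_space rs_space;
  atlas : set (chart R rs_space);
  atlas_cover : forall x, exists2 c, atlas c & chart_dom c x;
  atlas_holomorphic : forall c c' x, atlas c -> atlas c' ->
    chart_dom c x -> chart_dom c' x -> holomorphic_at (transition c c') (c x)
}.

Definition has_genus (R : realType) (X : riemannSurface R) (g : nat) : Prop :=
  exists f : {additive H1 R X -> 'rV[int]_(2 * g)}, bijective f.

Section Differentials.
Variables (R : realType) (X : riemannSurface R).

(* The section is coef c (z) dz^k in the coordinate z of the chart c. *)
Record differential (k : nat) := Differential {
  coef :> chart R X -> Cplx R -> Cplx R;
  coef_meromorphic : forall c x, atlas c -> chart_dom c x ->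
    meromorphic_at (coef c) (c x);
  coef_transition : forall c c' x, atlas c -> atlas c' ->
    chart_dom c x -> chart_dom c' x ->
    coef c (c x) = coef c' (c' x) * derive1 (transition c c') (c x) ^+ k;
  coef_nonzero : exists c x, [/\ atlas c, chart_dom c x & coef c (c x) != 0]
}.

Definition has_divisor k (q : differential k) (D : {freeg X}) : Prop :=
  forall c x, atlas c -> chart_dom c x -> has_order (q c) (c x) (coeff x D).

Definition canonical_divisor (D : {freeg X}) : Prop :=
  exists w : differential 1, has_divisor w D.

(* Nonzero meromorphic functions are the differentials of degree 0. *)
Definition linearly_equivalent (D D' : {freeg X}) : Prop :=
  exists f : differential 0, has_divisor f (D - D').

Definition is_power k j (q : differential k) (e : nat) (eta : differential j) :
  Prop :=
  forall c x, atlas c -> chart_dom c x -> q c (c x) = eta c (c x) ^+ e.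

Definition primitive k (q : differential k) : Prop :=
  forall e (eta : differential (k %/ e)%N),
    (1 < e)%N -> (e %| k)%N -> ~ is_power q e eta.

Variables (n : nat) (p : 'I_n -> X) (m : 'I_n -> int).

Definition cone_divisor : {freeg X} := \sum_i << m i *g p i >>.

Definition E : set nat := [set e | [/\ (1 <= e)%N, (e %| 4)%N,
  (forall i, e%:Z %| m i)%Z &
  exists2 K, canonical_divisor K &
    linearly_equivalent (\sum_i << (m i %/ e%:Z)%Z *g p i >>)
                        (K *+ (4 %/ e)%N)]].

End Differentials.

Definition topological_valence (m : int) : int := m + 4.

Section RotationalHolonomy.
Variables (R : realType) (X : riemannSurface R).

(* the local 1-form lf_coef(z) dz in the coordinate z of lf_chart *)
Record local_form := LocalForm {
  lf_chart : chart R X;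
  lf_coef : Cplx R -> Cplx R
}.

Definition scale_form (a : Cplx R) (w : local_form) : local_form :=
  LocalForm (lf_chart w) (fun z => a * lf_coef w z).

(* f(z) dz = f'(z') dz' near x, where z and z' are the coordinates of the two charts *)
Definition same_germ (x : X) (w w' : local_form) : Prop :=
  [/\ chart_dom (lf_chart w) x, chart_dom (lf_chart w') x &
   \forall y \near x, lf_coef w (lf_chart w y) = lf_coef w' (lf_chart w' y) *
     derive1 (transition (lf_chart w) (lf_chart w')) (lf_chart w y)].

Definition local_fourth_root (q : differential X 4) (x : X) (w : local_form) :
  Prop :=
  [/\ atlas (lf_chart w), chart_dom (lf_chart w) x,
      holomorphic_at (lf_coef w) (lf_chart w x) &
      \forall z \near lf_chart w x, lf_coef w z ^+ 4 = q (lf_chart w) z].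

Variables (n : nat) (p : 'I_n -> X).

Definition punctured : topologicalType := set_type (~` range p).

Definition root_continuation (q : differential X 4)
    (s : singular1 R punctured) (w : simplex1 R -> local_form) : Prop :=
  (forall t, local_fourth_root q (\val (s t)) (w t)) /\
  (forall t, \forall u \near t, same_germ (\val (s u)) (w u) (w t)).

Definition rotational_holonomy (q : differential X 4)
    (rho : {additive H1 R punctured -> 'Z_4}) : Prop :=
  forall (s : singular1 R punctured) (s01 : s (t0 R) = s (t1 R)) w,
    root_continuation q s w ->
    same_germ (\val (s (t0 R))) (w (t1 R))
      (scale_form ('i ^+ (rho (loop_class s01) : nat)) (w (t0 R))).

End RotationalHolonomy.

(* Main.v *)
From HB Require Import structures.
Require Import Defs.
From mathcomp Require Import all_boot all_order all_algebra.
From mathcomp Require Import all_classical all_reals all_analysis.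
From mathcomp Require Import complex freeg.
From mathcomp Require Import ring.

Set Implicit Arguments.
Unset Strict Implicit.
Unset Printing Implicit Defensive.

Import Order.TTheory GRing.Theory Num.Theory.
Import numFieldNormedType.Exports.
Local Open Scope classical_set_scope.
Local Open Scope ring_scope.

(** Everything is local around a cone [p i] with [m i] odd; such a cone exists
    because its valence is [m i + 4].

    An element [e] of [E p m] divides both [4] and the odd number [m i], so it
    is [1].  If [q] is the [e]-th power of [eta], then the order of [q] at [p i]
    is [e] times that of [eta] ([order_power], [power_divides_divisor]), so [e]
    again divides [m i], and [e = 1]; hence [q] is primitive.

    For the holonomy, a small loop around [p i] already generates: its holonomy
    is [m i] modulo 4, a unit.  In a coordinate centred at [z = c (p i)] write
    [q = (w - z) ^ (m i) * g w] with [g z != 0], and let [G] be a holomorphic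
    fourth root of [g].  The loop is [gam t = z + b t ^ 4], where [b] runs along
    a segment from [sigma] to ['i * sigma] that misses [0].  A path [b] chosen
    before [gam] makes [b t ^ (m i) * G (gam t)] a continuous fourth root of the
    values of [q] along the loop without any exponential or logarithm; [gam]
    closes up since ['i ^ 4 = 1], while the fourth root is multiplied by
    ['i ^ (m i)] ([cone_loop]).  An odd class generates
    ([odd_generates_Z4]), so only the parity of the holonomy is extracted
    ([odd_of_exprCi]).

    The holonomy is defined by germs of fourth roots and not by values, so the
    continuous choice of values has to be spread out to germs
    ([root_continuation_of_values]).  This rests on two facts: a nonvanishing
    holomorphic function has a holomorphic fourth root with any admissible
    value at the centre ([holomorphic_fourth_root]), and two continuous roots of
    the same function that agree at a point where they do not vanish agree near
    it ([eq_near_of_eq_pow]). *)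

(** * Holomorphic roots *)

Section HolomorphicRoots.
Variable R : realType.
Implicit Types (f g h : Cplx R -> Cplx R) (a s w z : Cplx R).

Lemma holomorphic_continuous {f z} :
  holomorphic_at f z -> {for z, continuous f}.
Proof.
by move=> /nbhs_singleton /derivable1_diffP; exact: differentiable_continuous.
Qed.

(** Of the two square roots of [w], the one closer to [1]: the principal branch,
    described in a way that makes its continuity near [1] a matter of norms. *)
Definition sqrt_near1 w : Cplx R :=
  if `|sqrtC w - 1| <= `|sqrtC w + 1| then sqrtC w else - sqrtC w.

Lemma sqrt_near1K w : sqrt_near1 w ^+ 2 = w.
Proof. by rewrite /sqrt_near1; case: ifP; rewrite ?sqrrN sqrtCK. Qed.

Lemma sqrt_near1_closer w : `|sqrt_near1 w - 1| <= `|sqrt_near1 w + 1|.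
Proof.
rewrite /sqrt_near1; case: ifP => // /negbT.
rewrite -real_ltNge ?normr_real // => /ltW.
by rewrite -opprD normrN [- _ + 1]addrC -opprB normrN.
Qed.

Lemma sqrt_near1_1 : sqrt_near1 1 = 1.
Proof.
have /eqP := sqrt_near1K 1; rewrite sqrf_eq1 => /orP[/eqP //|/eqP s].
have := sqrt_near1_closer 1; rewrite s addNr normr0 normr_le0.
by rewrite -opprD oppr_eq0 (_ : 1 + 1 = 2%:R) // pnatr_eq0.
Qed.

(** The product of the distances from the root to [1] and to [-1] is
    [`|w - 1|], and the first factor is the smaller one. *)
Lemma sqrt_near1_ball w : `|w - 1| < 1 -> `|sqrt_near1 w - 1| < 1.
Proof.
move=> w1; rewrite -(@ltr_pXn2r _ 2) ?nnegrE // expr1n.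
apply: le_lt_trans w1; rewrite -{2}(sqrt_near1K w) -{2}(expr1n _ 2) subr_sqr.
by rewrite normrM expr2 ler_wpM2l // sqrt_near1_closer.
Qed.

(** With [r], [s] the chosen roots of [z], [w], one has
    [(r - s) * (r + s) = z - w], and [r + s] stays away from [0] because both
    roots lie in the unit disc around [1]. *)
Lemma sqrt_near1_continuous z :
  `|z - 1| < 1 -> {for z, continuous sqrt_near1}.
Proof.
move=> z1; have sz1 := sqrt_near1_ball z1.
pose d := 1 - `|sqrt_near1 z - 1|.
have d_gt0 : 0 < d by rewrite subr_gt0.
apply/(@cvgrPdist_lt _ _ _ (nbhs z) _) => e e_gt0.
have ed_gt0 : 0 < e * d by rewrite mulr_gt0.
near=> w.
have w1 : `|w - 1| < 1.
  apply: le_lt_trans (ler_distD z w 1) _; rewrite -ltrBrDr distrC.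
  by near: w; apply: nbhsx_ballx; rewrite subr_gt0.
have sw1 := sqrt_near1_ball w1.
have d_le : d <= `|sqrt_near1 z + sqrt_near1 w|.
  have -> : sqrt_near1 z + sqrt_near1 w
      = 1 + 1 - ((1 - sqrt_near1 w) - (sqrt_near1 z - 1)) by ring.
  apply: le_trans (lerB_dist _ _).
  have n2 : `|1 + 1 : Cplx R| = 1 + 1 by rewrite ger0_norm ?addr_ge0.
  rewrite n2 /d -addrA lerD2l -[leLHS]add0r -(subrr 1) -addrA lerD2l.
  rewrite -opprD lerN2.
  apply: le_trans (ler_normB _ _) _.
  by rewrite distrC lerD2r ltW.
rewrite -(ltr_pM2r d_gt0).
apply: (@le_lt_trans _ _ (`|sqrt_near1 z - sqrt_near1 w|
                          * `|sqrt_near1 z + sqrt_near1 w|)).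
  by rewrite ler_wpM2l.
rewrite -normrM -subr_sqr !sqrt_near1K.
near: w; exact: cvgr_dist_lt.
Unshelve. all: by end_near.
Qed.

(** The difference quotient of a square root is the inverse of the sum of the
    two roots, so continuity gives the derivative. *)
Lemma sqrt_near1_derivable z : `|z - 1| < 1 -> derivable sqrt_near1 z 1.
Proof.
move=> z1.
have sz0 : sqrt_near1 z != 0.
  apply: contraTneq (sqrt_near1_ball z1) => ->.
  by rewrite sub0r normrN normr1 ltxx.
have cs := sqrt_near1_continuous z1.
apply/cvg_ex; exists ((sqrt_near1 z + sqrt_near1 z)^-1).
have : (sqrt_near1 (h + z) + sqrt_near1 z)^-1 @[h --> 0^'] -->
    (sqrt_near1 z + sqrt_near1 z)^-1.
  apply: cvgV; first by rewrite -mulr2n mulrn_eq0.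
  apply: cvgD; last exact: cvg_cst.
  have hz : h + z @[h --> 0^'] --> z.
    rewrite -{2}[z]add0r; apply: cvgD; last exact: cvg_cst.
    exact: cvg_within.
  exact: cvg_comp hz cs.
apply: cvg_trans; apply: near_eq_cvg.
near=> h.
have h0 : h != 0 by near: h; exact: nbhs_dnbhs_neq.
have : h = (sqrt_near1 (h + z) - sqrt_near1 z)
         * (sqrt_near1 (h + z) + sqrt_near1 z).
  by rewrite -subr_sqr !sqrt_near1K addrK.
rewrite /= /shift /= [h *: _]mulr1 => hE.
have : (sqrt_near1 (h + z) + sqrt_near1 z) != 0.
  by apply: contra_neq h0 => s0; rewrite hE s0 mulr0.
move=> s0; rewrite [_ *: _]mulrC; apply: (mulIf s0).
by rewrite mulVf // mulrAC -hE mulfV.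
Unshelve. all: by end_near.
Qed.

(** Dividing [f] by its value [a ^+ 2] moves it near [1]. *)
Lemma holomorphic_sqrt f z a : a != 0 -> holomorphic_at f z -> f z = a ^+ 2 ->
  exists h, [/\ holomorphic_at h z, h z = a
              & \forall w \near z, h w ^+ 2 = f w].
Proof.
move=> a0 fz fza; have a20 : a ^+ 2 != 0 by rewrite expf_neq0.
pose u w := f w * (a ^+ 2)^-1.
exists (fun w => a * sqrt_near1 (u w)); split.
- have cf := holomorphic_continuous fz.
  have cu : {for z, continuous u}.
    apply: (@continuousM _ _ f (fun=> (a ^+ 2)^-1)); first exact: cf.
    exact: cst_continuous.
  have uz : u z = 1 by rewrite /u fza mulfV.
  have u1 : \forall w \near z, `|u w - 1| < 1.
    by near=> w; rewrite distrC -{1}uz; near: w; exact: cvgr_dist_lt.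
  apply: filterS2 fz u1 => w fw /sqrt_near1_derivable ds.
  have du : derivable u w 1.
    exact: (@derivableM _ _ f (fun=> (a ^+ 2)^-1)) fw (derivable_cst _ _ _).
  have dsu : derivable (sqrt_near1 \o u) w 1.
    move/derivable1_diffP: du => du; move/derivable1_diffP: ds => ds.
    exact/derivable1_diffP/(differentiable_comp du ds).
  exact: derivableM (derivable_cst _ _ _) dsu.
- by rewrite /u fza mulfV // sqrt_near1_1 mulr1.
- by near=> w; rewrite exprMn sqrt_near1K mulrC mulfVK.
Unshelve. all: by end_near.
Qed.

Lemma holomorphic_fourth_root f z a :
  a != 0 -> holomorphic_at f z -> f z = a ^+ 4 ->
  exists h, [/\ holomorphic_at h z, h z = a
              & \forall w \near z, h w ^+ 4 = f w].
Proof.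
move=> a0 fz fza.
rewrite (exprM a 2 2) in fza.
have [h2 [h2z h2a h2f]] := holomorphic_sqrt (expf_neq0 2 a0) fz fza.
have [h [hz ha hh2]] := holomorphic_sqrt a0 h2z h2a.
exists h; split=> //; apply: filterS2 hh2 h2f => w e2 <-.
by rewrite (exprM _ 2 2) e2.
Qed.

Lemma continuous_pow (T : topologicalType) (x : T) (u : T -> Cplx R) j :
  {for x, continuous u} -> u y ^+ j @[y --> x] --> u x ^+ j.
Proof.
move=> cu; elim: j => [|j IHj]; first exact: cvg_cst.
have -> : (fun y => u y ^+ j.+1) = (fun y => u y * u y ^+ j).
  by apply/funext => y; rewrite exprS.
rewrite exprS.
exact: (@cvgM _ _ (nbhs x) _ u (fun y => u y ^+ j) _ _ cu IHj).
Qed.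

Lemma continuous_exprz (T : topologicalType) (u : T -> Cplx R) (k : int) :
  continuous u -> (forall x, u x != 0) -> continuous (fun x => u x ^ k).
Proof.
move=> cu u0 x; case: k => k; first exact: (continuous_pow (j := k) (cu x)).
have ck := continuous_pow (j := k.+1) (cu x).
by apply: (@cvgV _ _ (nbhs x) _ (fun x => u x ^+ k.+1)) ck; rewrite expf_neq0.
Qed.

(** In [u ^+ k - v ^+ k = (u - v) * S] the cofactor [S] is [k * v ^+ k.-1 != 0]
    at [x], hence nonzero near [x]. *)
Lemma eq_near_of_eq_pow (T : topologicalType) (x : T) (u v : T -> Cplx R) k :
  (0 < k)%N -> {for x, continuous u} -> {for x, continuous v} ->
  u x = v x -> v x != 0 -> (\forall y \near x, u y ^+ k = v y ^+ k) ->
  \forall y \near x, u y = v y.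
Proof.
move=> k_gt0 cu cv uv v0 uvk.
pose S y := \sum_(i < k) u y ^+ (k.-1 - i) * v y ^+ i.
have cS : S y @[y --> x] --> S x.
  apply: cvg_big => [|i _]; first exact: add_continuous.
  by apply: cvgM; exact: continuous_pow.
have S0 : S x != 0.
  rewrite /S uv (eq_bigr (fun=> v x ^+ k.-1)) => [|i _]; last first.
    by rewrite -exprD subnK // -ltnS prednK.
  rewrite sumr_const card_ord -mulr_natr.
  by rewrite mulf_neq0 ?expf_neq0 ?pnatr_eq0 -?lt0n.
near=> y.
have Sy0 : S y != 0 by near: y; exact: cvgr_neq0 cS S0.
have ek : u y ^+ k = v y ^+ k by near: y.
apply/eqP; rewrite -subr_eq0 -(mulIr_eq0 _ (mulIf Sy0)).
by rewrite -subrXX ek subrr.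
Unshelve. all: by end_near.
Qed.

End HolomorphicRoots.

(** * Orders of meromorphic functions *)

Section Orders.
Variable R : realType.
Implicit Types (f g h : Cplx R -> Cplx R) (z w : Cplx R).

(** If [n < k], then near [z] and away from it [g] is a positive power of
    [w - z] times [h], so [g] would tend to [0] at [z].  The value of [h] at [z]
    is free: taking [h = 0] shows that a function of finite order does not
    vanish identically near [z]. *)
Lemma order_le f g h z (n k : int) :
  {for z, continuous g} -> {for z, continuous h} -> g z != 0 ->
  (\forall w \near z, f w = (w - z) ^ n * g w) ->
  (\forall w \near z, f w = (w - z) ^ k * h w) -> k <= n.
Proof.
move=> cg ch g0 fg fh; rewrite leNgt; apply/negP => n_lt_k.
have [j kE] : exists j : nat, k = n + j.+1%:Z.
  exists `|k - n|.-1%N; rewrite prednK ?absz_gt0 ?subr_eq0 ?gt_eqF //.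
  by rewrite gtz0_abs ?subr_gt0 // [n + _]addrC subrK.
have gE : \forall w \near z^', g w = (w - z) ^+ j.+1 * h w.
  apply: filterS3 (nbhs_dnbhs_neq z) (nbhs_dnbhs fg) (nbhs_dnbhs fh).
  move=> w wz -> fhw.
  have wz0 : w - z != 0 by rewrite subr_eq0.
  apply: (mulfI (expfz_neq0 n wz0)).
  by rewrite fhw kE expfzDr // mulrA.
have cw : {for z, continuous (fun w => w - z)}.
  exact: (@cvgB _ _ _ (nbhs z) _ id (fun=> z) _ _ (@cvg_id _ _) (cvg_cst _)).
have g_to_0 : g w @[w --> z^'] --> (0 : Cplx R).
  have : (w - z) ^+ j.+1 * h w @[w --> z^'] --> (z - z) ^+ j.+1 * h z.
    by apply: cvgM; apply: cvg_within_filter; [exact: continuous_pow|exact: ch].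
  rewrite subrr exprS !mul0r; apply: cvg_trans; apply: near_eq_cvg.
  by apply: filterS gE => w ->.
have g_to_gz : g w @[w --> z^'] --> g z.
  exact: (@cvg_within_filter _ _ g (nbhs z) _ _ _ cg).
have := cvg_unique (@norm_hausdorff _ _) g_to_0 g_to_gz.
by move=> gz0; rewrite -gz0 eqxx in g0.
Qed.

Lemma order_power f g z n e : has_order f z n -> meromorphic_at g z ->
  (\forall w \near z, f w = g w ^+ e) -> (0 < e)%N -> (e%:Z %| n)%Z.
Proof.
move=> [u [/holomorphic_continuous cu u0 fu]] g_mero fg e_gt0.
case: g_mero => [g0|[k [v [/holomorphic_continuous cv v0 gv]]]].
  have : n + 1 <= n.
    have c0 : {for z, continuous (fun=> 0 : Cplx R)} by exact: cst_continuous.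
    apply: (order_le cu c0 u0 fu).
    apply: filterS2 fg g0 => w -> ->.
    by rewrite mulr0 expr0n -(prednK e_gt0).
  by rewrite gerDl ler10.
have fv : \forall w \near z, f w = (w - z) ^ (k * e%:Z) * v w ^+ e.
  by apply: filterS2 fg gv => w -> ->; rewrite exprMn exprnP exprz_exp.
have cve : {for z, continuous (fun w => v w ^+ e)} by exact: continuous_pow.
suff -> : n = k * e%:Z by rewrite dvdz_mull.
apply/eqP; rewrite eq_le; apply/andP; split.
  by apply: (order_le cve cu _ fv fu); rewrite expf_neq0.
exact: (order_le cu cve u0 fu fv).
Qed.

Lemma order0_holomorphic f z :
  has_order f z 0 -> holomorphic_at f z /\ f z != 0.
Proof.
move=> [g [hg g0 fg]].
have fgz : \forall w \near z, f w = g w.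
  by apply: filterS fg => w ->; rewrite expr0z mul1r.
split; last by rewrite (nbhs_singleton fgz).
apply: filterS2 (near_join fgz) hg => w fgw; apply: near_eq_derivable.
by apply: filterS fgw.
Qed.

End Orders.

(** * Charts, divisors and continuation of fourth roots *)

Section Charts.
Variables (R : realType) (X : riemannSurface R) (c : chart R X).

Lemma chart_continuous x : chart_dom c x -> {for x, continuous c}.
Proof.
move=> cx; have := @chart_map_continuous _ _ c.
rewrite continuous_open_subspace; first by apply; exact: mem_set.
exact: chart_dom_open.
Qed.

Lemma near_chart_codom x : chart_dom c x ->
  \forall w \near c x, (c @` chart_dom c) w.
Proof.
move=> cx; apply: open_nbhs_nbhs; split; first exact: chart_codom_open.
by exists x.
Qed.

Lemma chart_inv_continuous_at w :
  (c @` chart_dom c) w -> {for w, continuous (chart_inv c)}.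
Proof.
move=> cw; have := @chart_inv_continuous _ _ c.
rewrite continuous_open_subspace; first by apply; exact: mem_set.
exact: chart_codom_open.
Qed.

Lemma chart_invK w : (c @` chart_dom c) w -> c (chart_inv c w) = w.
Proof. by move=> [x cx <-]; rewrite chart_mapK. Qed.

Lemma chart_inv_dom w : (c @` chart_dom c) w -> chart_dom c (chart_inv c w).
Proof. by move=> [x cx <-]; rewrite chart_mapK. Qed.

Lemma derive1_transition_self x : chart_dom c x ->
  derive1 (transition c c) (c x) = 1.
Proof.
move=> cx; rewrite derive1E.
have eq_id : \forall w \near c x, transition c c w = id w.
  by apply: filterS (near_chart_codom cx) => w; exact: chart_invK.
by rewrite (@near_eq_derive _ _ _ _ id (c x) 1) ?derive_id.
Qed.

(** Two forms written in the same chart need only be compared by their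
    coefficients, the transition from a chart to itself being the identity. *)
Lemma same_germ_self x f g : chart_dom c x ->
  (\forall w \near c x, f w = g w) ->
  same_germ x (LocalForm c f) (LocalForm c g).
Proof.
move=> cx fg; split=> //=.
have fgx : \forall y \near x, f (c y) = g (c y).
  exact: (chart_continuous cx fg).
have dx : \forall y \near x, chart_dom c y.
  by apply: open_nbhs_nbhs; split=> //; exact: chart_dom_open.
by apply: filterS2 fgx dx => y fgy cy; rewrite derive1_transition_self // mulr1.
Qed.

Lemma same_germ_self_value x f g :
  same_germ x (LocalForm c f) (LocalForm c g) -> f (c x) = g (c x).
Proof.
move=> [/= cx _ /nbhs_singleton ->].
by rewrite derive1_transition_self // mulr1.
Qed.

End Charts.

Section Divisors.
Variables (R : realType) (X : riemannSurface R).

Lemma coeff_cone_divisor n (p : 'I_n -> X) (m : 'I_n -> int) (x : X) :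
  coeff x (cone_divisor p m) = \sum_i m i * (p i == x)%:R.
Proof.
rewrite /cone_divisor (big_morph (coeff x) (coeffD x) (coeff0 _ x)).
by apply: eq_bigr => i _; rewrite coeffU.
Qed.

Lemma coeff_cone_divisor_cone n (p : 'I_n -> X) (m : 'I_n -> int) i :
  injective p -> coeff (p i) (cone_divisor p m) = m i.
Proof.
move=> p_inj; rewrite coeff_cone_divisor (bigD1 i) //= eqxx mulr1.
by rewrite big1 ?addr0 // => j ji; rewrite (inj_eq p_inj) (negbTE ji) mulr0.
Qed.

Lemma coeff_cone_divisor_regular n (p : 'I_n -> X) (m : 'I_n -> int) (x : X) :
  ~ range p x -> coeff x (cone_divisor p m) = 0.
Proof.
move=> px; rewrite coeff_cone_divisor big1 // => i _.
by case: eqP => [pi|_]; [case: px; exists i|rewrite mulr0].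
Qed.

Lemma power_divides_divisor k j (q : differential X k) (eta : differential X j)
    D e x : has_divisor q D -> (0 < e)%N -> is_power q e eta ->
  (e%:Z %| coeff x D)%Z.
Proof.
move=> qD e_gt0 qeta; have [c ac cx] := @atlas_cover _ X x.
apply: (order_power (qD _ _ ac cx) (coef_meromorphic eta ac cx)) => //.
apply: filterS (near_chart_codom cx) => _ [y cy <-]; exact: qeta.
Qed.

End Divisors.

Section RootContinuation.
Variables (R : realType) (X : riemannSurface R) (n : nat) (p : 'I_n -> X).
Variables (q : differential X 4) (c : chart R X).
Variables (s : singular1 R (punctured p)) (a : simplex1 R -> Cplx R).
Let P t := c (\val (s t)).

(** At each time take the local fourth root [h t] of [q] with the prescribed
    value [a t].  For [u] near [t], both [h t] and [a] are continuous fourth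
    roots of [q] along the path that agree at [t], so [h t] takes the value
    [a u] at the point of time [u]; there it meets [h u], and the two branches
    coincide around that point. *)
Lemma root_continuation_of_values :
  atlas c -> (forall t, chart_dom c (\val (s t))) ->
  (forall t, holomorphic_at (q c) (P t)) ->
  continuous a -> (forall t, a t != 0) -> (forall t, a t ^+ 4 = q c (P t)) ->
  exists h : simplex1 R -> Cplx R -> Cplx R,
    root_continuation q s (fun t => LocalForm c (h t)) /\
    forall t, h t (P t) = a t.
Proof.
move=> ac cs qh ca a0 a4.
have [h hP] := choice (fun t =>
  holomorphic_fourth_root (a0 t) (qh t) (esym (a4 t))).
exists h; split; last by move=> t; have [] := hP t.
split=> [t|t]; first by have [h1 h2 h3] := hP t; split.
have cP : {for t, continuous P}.
  apply: (@continuous_comp _ _ _ (\val \o s) c); last first.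
    exact: (chart_continuous (cs t)).
  apply: (@continuous_comp _ _ _ s \val); first exact: cts_fun.
  exact: initial_continuous.
have [hol_ht htP ht4] := hP t.
have chP : {for t, continuous (h t \o P)}.
  exact: (continuous_comp cP (holomorphic_continuous hol_ht)).
have hP4 : \forall u \near t, (h t \o P) u ^+ 4 = a u ^+ 4.
  have ht4P : \forall u \near t, h t (P u) ^+ 4 = q c (P u).
    exact: (cP _ ht4).
  by apply: filterS ht4P => u; rewrite a4.
have ht_at_u : \forall u \near t, h t (P u) = a u.
  exact: (eq_near_of_eq_pow (k := 4) isT chP (ca t) htP (a0 t) hP4).
have ht4_u : \forall u \near t, \forall w \near P u, h t w ^+ 4 = q c w.
  exact: (cP _ (near_join ht4)).
have hol_u : \forall u \near t, holomorphic_at (h t) (P u).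
  exact: (cP _ (near_join hol_ht)).
apply: filterS3 ht_at_u ht4_u hol_u => u htu ht4u hu.
apply: same_germ_self; first exact: cs.
have [hol_hu huP hu4] := hP u.
have eq4 : \forall w \near P u, h u w ^+ 4 = h t w ^+ 4.
  by apply: filterS2 hu4 ht4u => w -> ->.
have eqP : h u (P u) = h t (P u) by rewrite huP htu.
have nz : h t (P u) != 0 by rewrite htu.
exact: (eq_near_of_eq_pow (k := 4) isT (holomorphic_continuous hol_hu)
  (holomorphic_continuous hu) eqP nz eq4).
Qed.

End RootContinuation.

(** * The loop around a cone *)

Section Segment.
Variable R : realType.
Implicit Types t : simplex1 R.

Lemma norm_real_complex (x : R) : `|x%:C%C : Cplx R| = (`|x|)%:C%C.
Proof. by rewrite /Cplx normc_def /= expr0n addr0 sqrtr_sqr. Qed.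

Lemma real_complex_continuous : continuous (fun x : R => x%:C%C : Cplx R).
Proof.
move=> x; apply/(@cvgrPdist_lt _ _ _ (nbhs x) _) => e.
rewrite ltcE /= => /andP[/eqP e_im e_re].
near=> y.
rewrite -(rmorphB (@real_complex R)) norm_real_complex ltcE /= -e_im eqxx /=.
near: y; apply: cvgr_dist_lt => //; exact: cvg_id.
Unshelve. all: by end_near.
Qed.

(** The image of this segment under [w |-> w ^+ 4] is a loop around [0] with
    base point [1], for which the segment is a choice of fourth roots. *)
Definition segment_1i t : Cplx R := 1 + (\val t)%:C%C * ('i - 1).

Lemma segment_1i_0 : segment_1i (t0 R) = 1.
Proof. by rewrite /segment_1i /= mul0r addr0. Qed.

Lemma segment_1i_1 : segment_1i (t1 R) = 'i.
Proof. by rewrite /segment_1i /= mul1r addrC subrK. Qed.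

Lemma segment_1i_neq0 t : segment_1i t != 0.
Proof.
rewrite /segment_1i -complexiE; case: t => t tI /=.
rewrite eq_complex /= negb_and; apply/orP.
have [->|t_neq0] := eqVneq t 0.
  by left; rewrite !mul0r subr0 addr0 oner_eq0.
by right; rewrite mul0r addr0 add0r subr0 mulr1.
Qed.

Lemma norm_segment_1i t : `|segment_1i t| <= 1.
Proof.
have -> : segment_1i t = (1 - \val t)%:C%C + (\val t)%:C%C * 'i.
  by rewrite /segment_1i rmorphB rmorph1; ring.
case: t => t /= /set_mem; rewrite /simplex1 /= in_itv /= => /andP[t_ge0 t_le1].
apply: le_trans (ler_normD _ _) _.
rewrite normrM normCi mulr1 !norm_real_complex !ger0_norm ?subr_ge0 //.
by rewrite -rmorphD subrK.
Qed.

Lemma segment_1i_continuous : continuous segment_1i.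
Proof.
move=> t.
have ct : {for t, continuous (fun t : simplex1 R => (\val t)%:C%C : Cplx R)}.
  apply: (@continuous_comp _ _ _ (\val : simplex1 R -> R)).
    exact: val_simplex1_continuous.
  exact: real_complex_continuous.
have cm : {for t, continuous (fun t : simplex1 R =>
    (\val t)%:C%C * ('i - 1) : Cplx R)}.
  exact: (@cvgM _ _ (nbhs t) _ (fun t : simplex1 R => (\val t)%:C%C : Cplx R)
    (fun=> 'i - 1) _ _ ct (cvg_cst _)).
have c1 : {for t, continuous (fun=> 1 : Cplx R)} by exact: cst_continuous.
exact: (continuousD c1 cm).
Qed.

End Segment.

Section ConeLoop.
Variables (R : realType) (X : riemannSurface R) (n : nat) (p : 'I_n -> X).

(** The other cones that lie in the chart have coordinates different from that
    of [p i], and there are finitely many of them. *)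
Lemma near_cone_punctured (c : chart R X) i : chart_dom c (p i) ->
  \forall w \near c (p i), w != c (p i) -> ~ range p (chart_inv c w).
Proof.
move=> cpi.
have avoid j : \forall w \near c (p i), w != c (p i) -> chart_inv c w <> p j.
  have [cpij|cpij] := eqVneq (c (p j)) (c (p i)).
    apply: filterS (near_chart_codom cpi) => w cw /eqP wz wpj; apply: wz.
    by rewrite -(chart_invK cw) wpj.
  have ne : \forall w \near c (p i), w != c (p j).
    have d_gt0 : 0 < `|c (p i) - c (p j)|.
      by rewrite normr_gt0 subr_eq0 eq_sym.
    apply: filterS (nbhsx_ballx (c (p i)) _ d_gt0) => w.
    by rewrite -ball_normE /=; apply: contraTneq => ->; rewrite ltxx.
  apply: filterS2 (near_chart_codom cpi) ne => w cw /eqP wpj _ wE; apply: wpj.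
  by rewrite -(chart_invK cw) wE.
apply: filterS (filter_forall _ avoid) => w avw wz [j _ pjw].
exact: (avw j wz).
Qed.

(** Along [z + b t ^+ 4] the function [q] has the continuous fourth root
    [b t ^ m i * G (gam t)], and [b] ends at ['i] times its starting value.  The
    conclusion determines [k] modulo 4, as the class of [m i], from the
    comparison of the last germ with the first. *)
Lemma cone_loop (q : differential X 4) (m : 'I_n -> int) i :
  injective p -> has_divisor q (cone_divisor p m) ->
  exists (s : singular1 R (punctured p)) (s01 : s (t0 R) = s (t1 R))
    (w : simplex1 R -> local_form X),
    root_continuation q s w /\
    forall k : nat, same_germ (\val (s (t0 R))) (w (t1 R))
      (scale_form ('i ^+ k) (w (t0 R))) -> 'i ^ (m i) = 'i ^+ k :> Cplx R.
Proof.
move=> p_inj qD.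
have [c ac cpi] := @atlas_cover _ X (p i).
have := qD c (p i) ac cpi; rewrite coeff_cone_divisor_cone //.
set z := c (p i) => -[g [hol_g g0 qg]].
have [r r4] : exists r : Cplx R, r ^+ 4 = g z.
  by exists (4.-root (g z)); rewrite rootCK.
have r0 : r != 0 by apply: contra_neq g0 => rE; rewrite -r4 rE expr0n.
have [G [hol_G Gz G4]] := holomorphic_fourth_root r0 hol_g (esym r4).
have cG : \forall w \near z, {for w, continuous G}.
  by apply: filterS (near_join hol_G) => w; exact: holomorphic_continuous.
have good : \forall w \near z, [/\ (c @` chart_dom c) w, {for w, continuous G},
    G w ^+ 4 = g w, q c w = (w - z) ^ m i * g w
    & w != z -> ~ range p (chart_inv c w)].
  have np := near_cone_punctured cpi.
  have nc := near_chart_codom cpi.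
  near=> w; split; near: w => //.
have [e /= e_gt0 ball_good] := (nbhs_ballP _ _).1 good.
(* This [sigma] puts the loop in the ball of radius [e]: its points are at
   distance at most [`|sigma ^+ 4| = e / 2] from [z], as the segment lies in the
   closed unit disc. *)
pose sigma : Cplx R := 4.-root (e / 2).
have sigma4 : sigma ^+ 4 = e / 2 by rewrite rootCK.
have sigma0 : sigma != 0.
  apply: contra_eq_neq sigma4 => ->.
  by rewrite expr0n eq_sym mulf_neq0 ?invr_eq0 ?pnatr_eq0 // gt_eqF.
pose b t := sigma * segment_1i t.
have b0 t : b t != 0 by rewrite mulf_neq0 ?segment_1i_neq0.
have cb : continuous b.
  move=> t; have cs : {for t, continuous (fun=> sigma)}.
    exact: cst_continuous.
  exact: (continuousM cs (@segment_1i_continuous R t)).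
pose gam t := z + b t ^+ 4.
have gamz t : gam t != z.
  by rewrite -subr_eq0 /gam addrC addKr expf_neq0.
have cgam : continuous gam.
  move=> t; have cz : {for t, continuous (fun=> z)} by exact: cst_continuous.
  have cb4 : {for t, continuous (fun t => b t ^+ 4)}
    by exact: (continuous_pow (j := 4) (cb t)).
  exact: (continuousD cz cb4).
have gam_good t : [/\ (c @` chart_dom c) (gam t), {for gam t, continuous G},
    G (gam t) ^+ 4 = g (gam t), q c (gam t) = (gam t - z) ^ m i * g (gam t)
    & gam t != z -> ~ range p (chart_inv c (gam t))].
  apply: ball_good; rewrite -ball_normE /= /gam opprD addrA subrr sub0r normrN.
  have e2_gt0 : 0 < e / 2 by rewrite divr_gt0.
  rewrite exprMn sigma4 normrM normrX (gtr0_norm e2_gt0).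
  apply: (@le_lt_trans _ _ (e / 2)); last first.
    by rewrite ltr_pdivrMr // ltr_pMr // ltr1n.
  by rewrite ler_piMr ?(ltW e2_gt0) // exprn_ile1 ?norm_segment_1i.
have gam_codom t : (c @` chart_dom c) (gam t) by have [] := gam_good t.
have sP t : chart_inv c (gam t) \in ~` range p.
  by apply/mem_set; have [_ _ _ _] := gam_good t; apply.
pose s0 (t : simplex1 R) : punctured p := exist _ (chart_inv c (gam t)) (sP t).
have cs0 : continuous s0.
  apply/continuous_comp_initial => t.
  apply: (@continuous_comp _ _ _ gam (chart_inv c)); first exact: cgam.
  exact: chart_inv_continuous_at.
pose sM := isContinuous.Build _ _ s0 cs0.
pose s : singular1 R (punctured p) := HB.pack s0 sM.
have s01 : s (t0 R) = s (t1 R).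
  apply: val_inj => /=; rewrite /gam /b segment_1i_0 segment_1i_1 !exprMn.
  by rewrite (exprM 'i 2 2) sqrCi sqrrN !expr1n.
pose a t := b t ^ m i * G (gam t).
have csE t : c (\val (s t)) = gam t by rewrite chart_invK.
have ca : continuous a.
  move=> t; have [_ cGt _ _ _] := gam_good t.
  have cbm : {for t, continuous (fun t => b t ^ m i)}.
    exact: (@continuous_exprz R _ b (m i) cb b0 t).
  exact: (continuousM cbm (continuous_comp (cgam t) cGt)).
(* The loop avoids the cones, so [q] has order [0] along it. *)
have regular t : holomorphic_at (q c) (gam t) /\ q c (gam t) != 0.
  apply: order0_holomorphic; rewrite -csE.
  rewrite -(coeff_cone_divisor_regular m (set_mem (sP t))).
  by apply: qD => //; exact: chart_inv_dom.
have a4 t : a t ^+ 4 = q c (gam t).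
  have [_ _ G4t -> _] := gam_good t.
  rewrite /a exprMn G4t; congr (_ * _).
  by rewrite /gam [z + _]addrC addrK !exprnP !exprz_exp mulrC.
have a0 t : a t != 0.
  by have [_] := regular t; rewrite -a4 expf_eq0.
have cs t : chart_dom c (\val (s t)) by exact: chart_inv_dom.
have hol_s t : holomorphic_at (q c) (c (\val (s t))).
  by rewrite csE; have [] := regular t.
have a4s t : a t ^+ 4 = q c (c (\val (s t))) by rewrite csE.
have [h [cont_h hval]] := root_continuation_of_values ac cs hol_s ca a0 a4s.
exists s, s01, (fun t => LocalForm c (h t)); split=> // k.
move=> /same_germ_self_value germ01.
have a01 : a (t1 R) = 'i ^+ k * a (t0 R).
  by rewrite -(hval (t0 R)) -(hval (t1 R)) -s01.
have gam01 : gam (t1 R) = gam (t0 R) by rewrite -!csE s01.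
have Gt0 : sigma ^ m i * G (gam (t0 R)) != 0.
  have := a0 (t0 R); by rewrite /a /b segment_1i_0 mulr1.
move: a01; rewrite /a gam01 /b segment_1i_0 segment_1i_1 mulr1 expfzMl.
rewrite [sigma ^ m i * 'i ^ m i]mulrC -mulrA; exact: (mulIf Gt0).
Unshelve. all: by end_near.
Qed.

End ConeLoop.

(** * Odd cones *)

(** Squaring ['i ^ k] gives [(-1) ^ k = -1], so the square of ['i ^+ r], which
    is [(-1) ^+ r], is not [1]. *)
Lemma odd_of_exprCi (C : numClosedFieldType) (k : int) (r : nat) :
  ~~ (2 %| k)%Z -> 'i ^ k = 'i ^+ r :> C -> odd r.
Proof.
move=> k_odd ikr; apply/negPn/negP => r_even.
have ir2 : 'i ^+ r ^+ 2 = 1 :> C.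
  by rewrite -exprM mulnC exprM sqrCi -signr_odd (negbTE r_even).
have /divzK kE : (2 %| k - 1)%Z.
  rewrite -eqz_mod_dvd; apply/eqP.
  have := ltz_pmod k (isT : 0 < 2 :> int).
  have := modz_ge0 k (isT : 2 != 0 :> int).
  by move/dvdz_mod0P: k_odd; case: (k %% 2)%Z => [[|[|]]|].
have ik2 : ('i ^ k) ^+ 2 = -1 :> C.
  rewrite exprnP exprz_exp mulrC -exprz_exp -exprnP sqrCi.
  rewrite -(subrK 1 k) -kE mulrC expfzDr ?oppr_eq0 ?oner_eq0 //.
  by rewrite -exprz_exp -exprnP sqrrN expr1n exp1rz mul1r expr1z.
move/eqP: ir2; rewrite -ikr ik2 eq_sym -addr_eq0.
by rewrite (_ : 1 + 1 = 2%:R) // pnatr_eq0.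
Qed.

Lemma odd_generates_Z4 (V : zmodType) (f : {additive V -> 'Z_4})
    (v : V) :
  odd (f v) -> range f = [set: 'Z_4].
Proof.
move=> fv_odd; apply/seteqP; split=> // y _.
exists (v *+ (f v * y)%N) => //.
rewrite raddfMn mulrnA.
(* Odd residues modulo 4 are their own inverses. *)
suff -> : f v *+ f v = 1 by rewrite natr_Zp.
by move: (f v) fv_odd => -[[|[|[|[|]]]] lt4] //= _; apply: val_inj.
Qed.

Theorem corollary6p9 (R : realType) (g n : nat) (m : 'I_n -> int)
    (m_gt : forall i, -4 < m i)
    (m_sum : \sum_i m i = 4 * (2 * g%:Z - 2))
    (m_odd : exists i, ~~ (2 %| topological_valence (m i))%Z)
    (X : riemannSurface R) (X_compact : compact [set: X])
    (X_genus : has_genus X g) (p : 'I_n -> X) (p_inj : injective p) :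
  E p m `<=` [set 1%N] /\
  forall q : differential X 4, has_divisor q (cone_divisor p m) ->
    primitive q /\
    forall rho : {additive H1 R (punctured p) -> 'Z_4},
      rotational_holonomy q rho -> range rho = [set: 'Z_4].
Proof.
case: m_odd => i val_odd.
have mi_odd : ~~ (2 %| m i)%Z.
  by apply: contra val_odd => mi2; rewrite rpredD.
have e_eq1 e : (e %| 4)%N -> (e%:Z %| m i)%Z -> e = 1%N.
  move=> e4 em; have : e \in divisors 4 by rewrite -dvdn_divisors.
  have e2 : (2 %| e)%N = false.
    apply: contraNF mi_odd => e2; exact: dvdz_trans em.
  move: e2; rewrite [divisors 4](_ : _ = [:: 1; 2; 4]%N) // !inE.
  by move=> e2 /or3P[] /eqP eE //; rewrite eE in e2.
split=> [e [_ e4 em _]|q qD]; first exact: e_eq1.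
split=> [e eta e_gt1 e4 qeta|rho rhoP].
  have := power_divides_divisor (p i) qD (ltnW e_gt1) qeta.
  rewrite coeff_cone_divisor_cone // => /(e_eq1 e e4) e1.
  by rewrite e1 in e_gt1.
have [s [s01 [w [cont_w monodromy]]]] := cone_loop i p_inj qD.
apply: (odd_generates_Z4 (v := loop_class s01)).
exact: odd_of_exprCi mi_odd (monodromy _ (rhoP _ _ _ cont_w)).
Qed.
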